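(* For every non-negative integer $k$ there exist: (i) a $5$-regular graph on $26+6k$ vertices with exactly $2^{k+10}\cdot 3^{k+3}$ hamiltonian cycles; (ii) a $6$-regular graph on $39+7k$ vertices with exactly $2^{3(k+4)}\cdot 3^{k+4}\cdot 5^5$ hamiltonian cycles; and (iii) a $7$-regular graph on $54+8k$ vertices with exactly $2^{3(k+8)}\cdot 3^{k+10}\cdot 5^{k+5}$ hamiltonian cycles.
   Context: Graphs are finite and simple. A hamiltonian cycle is a cycle through all vertices of the graph. *)

(* Defs.v *)
From mathcomp Require Import all_boot.

Set Implicit Arguments.
Unset Strict Implicit.
Unset Printing Implicit Defensive.

Record sgraph := SGraph {
  vertex :> finType;
  adj : rel vertex;
  adj_sym : symmetric adj;
  adj_irrefl : irreflexive adj
}.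

Definition degree (G : sgraph) (x : G) : nat := #|[set y | adj x y]|.

Definition regular (d : nat) (G : sgraph) : Prop := forall x : G, degree x = d.

Definition cycle_edges (T : finType) (c : seq T) : {set {set T}} :=
  [set [set x; next c x] | x in c].

(* A hamiltonian cycle is a subgraph; being spanning, it is determined by its
   edge set, so that the 2n rooted, oriented traversals of one cycle count
   once. A duplicate-free sequence of #|G| vertices visits every vertex. The
   bound 2 < #|G| is needed because ucycleb also accepts sequences of length
   at most 2. *)
Definition hamiltonian_cycle (G : sgraph) (C : {set {set G}}) : bool :=
  (2 < #|G|) &&
  [exists c : #|G|.-tuple G, ucycleb (@adj G) c && (C == cycle_edges c)].

Definition num_hamiltonian_cycles (G : sgraph) : nat :=
  #|[set C | @hamiltonian_cycle G C]|.

(* Main.v *)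
(* Call a graph with two terminals s, t of degree r - 1 and all other degrees r a
   link, and count its hamiltonian s-t paths. Putting a link in place of an edge
   xy forces every hamiltonian cycle to run through the link once, so that exactly
   the cycles through xy survive, each multiplied by the number of paths of the
   link. Edges still to be replaced are carried along as virtual edges, all of
   which a path has to use.

   The link K_{r+1} - ab has (r - 1)! paths. If in it the edge ac is replaced by
   another link, a path from a must enter that link at once and the remaining
   r - 2 vertices can be visited in any order: this adds r + 1 vertices and a factor
   (r - 2)!, which is the step from k to k + 1. For k = 0 one takes an r-regular
   graph on 3r - 7 vertices with a path of r - 2 edges that lies in exactly 2, 5
   or 16 hamiltonian cycles (r = 5, 6, 7), and replaces these r - 2 edges by copies of
   K_{r+1} - ab; the other edges at the interior vertices of that path lie on none of
   these cycles, which keeps their number small. *)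
Require Import Defs.
From mathcomp Require Import all_boot ring.

Set Implicit Arguments.
Unset Strict Implicit.
Unset Printing Implicit Defensive.

(** * Paths with virtual edges *)

Section Steps.

Variable T : eqType.
Implicit Types (p q V : seq T) (x y s t : T) (l F : seq (T * T)) (e : rel T).

Definition steps p := zip p (behead p).

Definition joined l x y := ((x, y) \in l) || ((y, x) \in l).

Lemma joinedC l x y : joined l x y = joined l y x.
Proof. exact: orbC. Qed.

Lemma steps_cat p1 x y p2 :
  steps (rcons p1 x ++ y :: p2) = steps (rcons p1 x) ++ (x, y) :: steps (y :: p2).
Proof. by elim: p1 => [|a [|b p1] IH] //=; rewrite -IH. Qed.

Lemma steps_cat_head z p q : p != [::] -> q != [::] ->
  steps (p ++ q) = steps p ++ (last z p, head z q) :: steps q.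
Proof. by case/lastP: p q => [|p x] [|y q] // _ _; rewrite steps_cat last_rcons. Qed.

Lemma mem_steps_cat p1 x y p2 : (x, y) \in steps (p1 ++ x :: y :: p2).
Proof. by rewrite -cat_rcons steps_cat mem_cat mem_head orbT. Qed.

Lemma steps_rcons p x y : steps (rcons (rcons p x) y) = rcons (steps (rcons p x)) (x, y).
Proof. by rewrite -cats1 steps_cat cats1. Qed.

Lemma steps_rev p : steps (rev p) = rev [seq (a.2, a.1) | a <- steps p].
Proof.
elim: p => [|x [|y p] IH] //; rewrite rev_cons.
rewrite [rev (y :: p)]rev_cons steps_rcons -rev_cons IH.
by rewrite [steps (x :: _)]/= map_cons rev_cons.
Qed.

Lemma mem_steps p x y : (x, y) \in steps p -> (x \in p) /\ (y \in p).
Proof.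
elim: p => [|a [|b p] IH] //=; rewrite inE => /orP [/eqP [-> ->]|].
  by rewrite !inE !eqxx orbT.
by move=> /IH [xp yp]; rewrite !(in_cons a) xp yp !orbT.
Qed.

Lemma steps_split p x y :
  (x, y) \in steps p -> exists p1 p2, p = rcons p1 x ++ y :: p2.
Proof.
elim: p => [|a [|b p] IH] //=; rewrite inE => /orP [/eqP [-> ->]|].
  by exists [::], p.
by move=> /IH [p1 [p2 eqp]]; exists (a :: p1), p2; rewrite eqp.
Qed.

Lemma joined_rev p x y : joined (steps (rev p)) x y = joined (steps p) x y.
Proof.
have swapI : injective (fun a : T * T => (a.2, a.1)) by move=> [a b] [c d] [-> ->].
have H u v : ((u, v) \in steps (rev p)) = ((v, u) \in steps p).
  by rewrite steps_rev mem_rev -[RHS](mem_map swapI).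
by rewrite /joined !H orbC.
Qed.

Lemma path_steps e x p : path e x p = all (fun a => e a.1 a.2) (steps (x :: p)).
Proof. by elim: p x => [|y p IH] x //=; rewrite IH. Qed.

(* The pairs in [F] are virtual edges: they may be used besides the edges of [e],
   and each of them must be used. *)
Definition ham_path V e F s t p :=
  [&& perm_eq p V, head s p == s, last s p == t,
      all (fun a => e a.1 a.2 || joined F a.1 a.2) (steps p)
    & all (fun f => joined (steps p) f.1 f.2) F].

Lemma eq_ham_path V e e' F s t p :
  e =2 e' -> ham_path V e F s t p = ham_path V e' F s t p.
Proof.
by move=> ee'; congr [&& _, _, _, _ & _]; apply: eq_all => a; rewrite ee'.
Qed.

Lemma ham_path_swap V e x y F s t p :
  ham_path V e ((x, y) :: F) s t p = ham_path V e ((y, x) :: F) s t p.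
Proof.
have eqF u v : joined ((x, y) :: F) u v = joined ((y, x) :: F) u v.
  rewrite /joined !in_cons !xpair_eqE.
  rewrite orbACA [RHS]orbACA [(v == x) && _]andbC [(v == y) && _]andbC.
  by congr (_ || _); apply: orbC.
congr [&& _, _, _, _ & _]; first by apply: eq_all => a; rewrite eqF.
by rewrite /= joinedC.
Qed.

Lemma ham_path_rev V e F s t p : symmetric e ->
  ham_path V e F s t p -> ham_path V e F t s (rev p).
Proof.
move=> e_sym /and5P [pV ps pt pe pF]; apply/and5P; split.
- by rewrite perm_rev.
- by case/lastP: p pt {ps pV pe pF} => [|p x]; rewrite ?last_rcons ?rev_rcons ?eqxx.
- by case: p ps pt {pV pe pF} => [|x p]; rewrite ?rev_cons ?last_rcons //= eq_sym.
- rewrite steps_rev all_rev all_map; apply: sub_all pe => a /=.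
  by rewrite e_sym joinedC.
- by apply: sub_all pF => a; rewrite joined_rev.
Qed.

End Steps.

Section Map.

Variables (T T' : eqType) (f : T -> T').
Hypothesis f_inj : injective f.

Definition mapp (a : T * T) := (f a.1, f a.2).

Lemma mapp_inj : injective mapp.
Proof. by move=> [a b] [c d] [/f_inj -> /f_inj ->]. Qed.

Lemma steps_map p : steps (map f p) = map mapp (steps p).
Proof. by elim: p => [|x [|y p] IH] //=; rewrite -IH. Qed.

Lemma joined_map l x y : joined (map mapp l) (f x) (f y) = joined l x y.
Proof.
by rewrite /joined -[(f x, _)]/(mapp (x, y)) -[(f y, _)]/(mapp (y, x))
   !(mem_map mapp_inj).
Qed.

Lemma ham_path_map V (e : rel T') F s t p :
  ham_path (map f V) e (map mapp F) (f s) (f t) (map f p)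
  = ham_path V (relpre f e) F s t p.
Proof.
rewrite /ham_path steps_map !all_map last_map; congr [&& _, _, _, _ & _].
- by apply/idP/idP; [apply: perm_map_inj | apply: perm_map].
- by case: p => [|x p] /=; rewrite ?eqxx // (inj_eq f_inj).
- by rewrite (inj_eq f_inj).
- by apply: eq_all => a /=; rewrite joined_map.
- by apply: eq_all => a /=; rewrite joined_map.
Qed.

End Map.

(** * Replacing a virtual edge *)

Section SumSeq.

Variables T U : eqType.
Implicit Types w : seq (T + U).

Lemma inl_inj : injective (@inl T U). Proof. by move=> ? ? []. Qed.
Lemma inr_inj : injective (@inr T U). Proof. by move=> ? ? []. Qed.

Definition getl (z : T + U) := if z is inl x then Some x else None.
Definition getr (z : T + U) := if z is inr x then Some x else None.

Lemma getl_inl p : pmap getl (map inl p) = p.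
Proof. by elim: p => //= x p ->. Qed.
Lemma getl_inr q : pmap getl (map inr q) = [::].
Proof. by elim: q. Qed.
Lemma getr_inl p : pmap getr (map inl p) = [::].
Proof. by elim: p. Qed.
Lemma getr_inr q : pmap getr (map inr q) = q.
Proof. by elim: q => //= x q ->. Qed.

Definition getE := (pmap_cat, getl_inl, getl_inr, getr_inl, getr_inr, cats0, cat0s).

Lemma inl_run w : exists p w',
  w = map inl p ++ w' /\ (w' = [::] \/ exists u w'', w' = inr u :: w'').
Proof.
elim: w => [|[x|u] w [p [w' [-> H]]]]; first by exists [::], [::]; split; auto.
  by exists (x :: p), w'.
by exists [::], (inr u :: map inl p ++ w'); split=> //; right; eexists; eexists.
Qed.

Lemma inr_run w : exists q w',
  w = map inr q ++ w' /\ (w' = [::] \/ exists x w'', w' = inl x :: w'').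
Proof.
elim: w => [|[x|u] w [q [w' [-> H]]]]; first by exists [::], [::]; split; auto.
  by exists [::], (inl x :: map inr q ++ w'); split=> //; right; eexists; eexists.
by exists (u :: q), w'.
Qed.

Lemma mem_inl_cat x p q : ((inl x : T + U) \in map inl p ++ map inr q) = (x \in p).
Proof.
rewrite mem_cat (mem_map inl_inj); case: mapP => [[? _ //]|_]; exact: orbF.
Qed.
Lemma mem_inr_cat u p q : ((inr u : T + U) \in map inl p ++ map inr q) = (u \in q).
Proof. by rewrite mem_cat (mem_map inr_inj); case: mapP => [[? _ //]|_]. Qed.

Lemma uniq_sum p q :
  uniq (map inl p ++ map inr q : seq (T + U)) = uniq p && uniq q.
Proof.
rewrite cat_uniq (map_inj_uniq inl_inj) (map_inj_uniq inr_inj).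
case: (uniq p) => //=; case: hasP => [[_ /mapP [u _ ->] /mapP [] //]|//].
Qed.

End SumSeq.

Arguments inl_inj {T U}.
Arguments inr_inj {T U}.

Lemma perm_enum (T : finType) (p : seq T) :
  reflect (uniq p /\ forall x, x \in p) (perm_eq p (enum T)).
Proof.
apply: (iffP idP) => [pT|[up memp]].
  by split=> [|x]; rewrite ?(perm_uniq pT) ?enum_uniq // (perm_mem pT) mem_enum.
by apply: uniq_perm; rewrite ?enum_uniq // => x; rewrite memp mem_enum.
Qed.

Lemma perm_enum_sum (T U : finType) (p : seq T) (q : seq U) :
  perm_eq (map inl p ++ map inr q) (enum {: T + U})
  = perm_eq p (enum T) && perm_eq q (enum U).
Proof.
apply/perm_enum/andP; rewrite uniq_sum.
  move=> [/andP [up uq] H]; split; apply/perm_enum; split=> // x.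
    by have := H (inl x); rewrite mem_inl_cat.
  by have := H (inr x); rewrite mem_inr_cat.
move=> [/perm_enum [up hp] /perm_enum [uq hq]]; split; first by rewrite up.
by case=> x; rewrite ?mem_inl_cat ?mem_inr_cat.
Qed.

Section SpliceRel.

Variables (T U : finType) (e : rel T) (d : rel U).

Definition splice_rel x y a b : rel (T + U) := fun v w =>
  match v, w with
  | inl v, inl w => e v w
  | inr v, inr w => d v w
  | inl v, inr w => (v == x) && (w == a) || (v == y) && (w == b)
  | inr w, inl v => (v == x) && (w == a) || (v == y) && (w == b)
  end.

Lemma splice_rel_swap x y a b : splice_rel x y a b =2 splice_rel y x b a.
Proof. by move=> [v|v] [w|w] //=; rewrite orbC. Qed.

Lemma splice_rel_sym x y a b :
  symmetric e -> symmetric d -> symmetric (splice_rel x y a b).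
Proof. by move=> es ds [v|v] [w|w] //=. Qed.

Lemma splice_rel_irrefl x y a b :
  irreflexive e -> irreflexive d -> irreflexive (splice_rel x y a b).
Proof. by move=> es ds [v|v] /=. Qed.

Let lmapp := mapp (@inl T U).

Lemma ham_path_splice x y a b F s t p1 p2 q :
    ~~ joined F x y -> head a q = a -> last a q = b -> q != [::] ->
  ham_path (enum {: T + U}) (splice_rel x y a b) (map lmapp F) (inl s) (inl t)
    (map inl (rcons p1 x) ++ map inr q ++ map inl (y :: p2))
  = ham_path (enum T) e ((x, y) :: F) s t (rcons p1 x ++ y :: p2)
    && ham_path (enum U) d [::] a b q.
Proof.
move=> nFxy qa qb q0; set p := rcons p1 x ++ y :: p2; set w := (X in ham_path _ _ _ _ _ X).
have permw : perm_eq w (map inl p ++ map inr q).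
  by rewrite /w /p map_cat -catA perm_cat2l perm_catC.
have stepw : steps w = map lmapp (steps (rcons p1 x)) ++ (inl x, inr a)
   :: map (mapp inr) (steps q) ++ (inr b, inl y) :: map lmapp (steps (y :: p2)).
  rewrite /w map_rcons (steps_cat_head (inr a)); first last.
  - by case: (q) q0.
  - by case: (p1).
  rewrite -(map_rcons inl) steps_map (steps_cat_head (inr a)) //;
    last by case: (q) q0.
  rewrite (last_map inr) qb !steps_map map_rcons last_rcons.
  by congr (_ ++ (_, _) :: _); case: (q) q0 qa => //= a' q' _ ->.
have stepp : steps p = steps (rcons p1 x) ++ (x, y) :: steps (y :: p2).
  exact: steps_cat.
have Hhead : (head (inl s) w == inl s) = (head s p == s).
  by rewrite /w /p; case: (p1) => [|z p1'] /=; rewrite (inj_eq inl_inj).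
have Hlast : (last (inl s) w == inl t) = (last s p == t).
  by rewrite /w /p !last_cat /= last_map (inj_eq inl_inj).
have [Pp|nPp] := boolP (perm_eq p (enum T)); last first.
  by rewrite /ham_path (permPl permw) perm_enum_sum (negbTE nPp).
have /perm_enum [] := Pp; rewrite cat_uniq => /and3P [_ dis _] _.
have [xp2 yp1] : x \notin y :: p2 /\ y \notin rcons p1 x.
  split; apply: contra dis => Hin; apply/hasP.
    by exists x; rewrite // mem_rcons mem_head.
  by exists y; rewrite // mem_head.
have notAB : {in steps (rcons p1 x) ++ steps (y :: p2),
    forall c, c != (x, y) /\ c != (y, x)}.
  move=> [c1 c2]; rewrite mem_cat => /orP [] /mem_steps [h1 h2].
    by split; apply: contraNneq yp1 => - [? ?]; subst c1 c2.
  by split; apply: contraNneq xp2 => - [? ?]; subst c1 c2.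
have Hrel : all (fun c => splice_rel x y a b c.1 c.2 || joined (map lmapp F) c.1 c.2)
      (steps w)
    = all (fun c => e c.1 c.2 || joined ((x, y) :: F) c.1 c.2) (steps p)
      && all (fun c => d c.1 c.2 || joined [::] c.1 c.2) (steps q).
  have joinl c : joined (map lmapp F) (inl c.1) (inl c.2) = joined F c.1 c.2.
    exact/joined_map/inl_inj.
  have joinr c : joined (map lmapp F) (inr c.1) (inr c.2) = false.
    by rewrite /joined; apply/norP; split; apply/negP => /mapP [].
  have restr l : {subset l <= steps (rcons p1 x) ++ steps (y :: p2)} ->
      all (fun c => e c.1 c.2 || joined ((x, y) :: F) c.1 c.2) l
      = all (fun c => e c.1 c.2 || joined F c.1 c.2) l.
    move=> sub; apply: eq_in_all => - [c1 c2] /sub /notAB [].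
    by rewrite /joined !inE ![(c2, c1) == _]xpair_eqE !xpair_eqE /=
         => /negbTE -> /negbTE nyx; rewrite [(c2 == x) && _]andbC nyx.
  rewrite stepw stepp !all_cat /= !all_cat /= !all_map !eqxx /= ?orbT /=.
  rewrite !restr; first last.
  - by move=> c cA; rewrite mem_cat cA.
  - by move=> c cA; rewrite mem_cat cA orbT.
  have -> : joined ((x, y) :: F) x y by rewrite /joined mem_head.
  rewrite orbT /= -andbA; congr (_ && _).
    by apply: eq_all => c /=; rewrite joinl.
  rewrite andbC; congr (_ && _).
    by apply: eq_all => c /=; rewrite joinl.
  by apply: eq_all => c /=; rewrite joinr.
have Hvirt : all (fun f => joined (steps w) f.1 f.2) (map lmapp F)
    = all (fun f => joined (steps p) f.1 f.2) ((x, y) :: F).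
  have -> /= : all (fun f => joined (steps p) f.1 f.2) ((x, y) :: F)
      = all (fun f => joined (steps p) f.1 f.2) F.
    by rewrite /= stepp /joined mem_cat mem_head orbT.
  rewrite all_map; apply: eq_in_all => - [f1 f2] fF /=.
  have mem_w c1 c2 : (c1, c2) != (x, y) ->
      ((inl c1, inl c2) \in steps w) = ((c1, c2) \in steps p).
    move=> ncxy; rewrite stepw stepp !mem_cat !inE mem_cat inE (negbTE ncxy) /=.
    rewrite -[(inl c1, _)]/(lmapp (c1, c2)) !(mem_map (mapp_inj inl_inj)).
    rewrite xpair_eqE andbF /=; congr (_ || _).
    by case: mapP => // - [].
  rewrite /joined !mem_w //.
    by apply: contraNneq nFxy => - [<- <-]; rewrite /joined fF orbT.
  by apply: contraNneq nFxy => - [<- <-]; rewrite /joined fF.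
rewrite /ham_path (permPl permw) perm_enum_sum Hhead Hlast Hrel Hvirt qa qb !eqxx.
rewrite Pp andbT /=; case: (perm_eq q _); rewrite ?andbF //=.
by rewrite -!andbA; do !bool_congr.
Qed.

Lemma splice_ham_decomp x y a b F s t w :
    ham_path (enum {: T + U}) (splice_rel x y a b) (map lmapp F) (inl s) (inl t) w ->
  exists p1 p2 q,
    q != [::] /\
    ([/\ w = map inl (rcons p1 x) ++ map inr q ++ map inl (y :: p2),
         head a q = a & last a q = b]
  \/ [/\ w = map inl (rcons p1 y) ++ map inr q ++ map inl (x :: p2),
         head b q = b & last b q = a]).
Proof.
case/and5P => /perm_enum [uw mw] /eqP hw /eqP lw ew _.
have lr v u : (inl v, inr u) \in steps w -> (v, u) = (x, a) \/ (v, u) = (y, b).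
  move/(allP ew) => /=; rewrite /joined /=.
  case/orP => [/orP []/andP [/eqP -> /eqP ->]|]; auto.
  by case/orP => /mapP [] [].
have rl v u : (inr u, inl v) \in steps w -> (v, u) = (x, a) \/ (v, u) = (y, b).
  move/(allP ew) => /=; rewrite /joined /=.
  case/orP => [/orP []/andP [/eqP -> /eqP ->]|]; auto.
  by case/orP => /mapP [] [].
have [p1 [w1 [eqw]]] := inl_run w.
case=> [w10|[u [w1' eqw1]]].
  by have := mw (inr a); rewrite eqw w10 cats0 => /mapP [].
case/lastP: p1 eqw => [|p1 z] eqw; first by rewrite eqw eqw1 in hw.
have [q [w2 [eqw1' Hw2]]] := inr_run w1'.
case: Hw2 => [w20|[z' [w2' eqw2]]].
  by move: lw; rewrite eqw eqw1 eqw1' w20 cats0 last_cat /= last_map.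
have [p2 [w3 [eqw2' Hw3]]] := inl_run w2'.
have {}eqw : w = map inl (rcons p1 z) ++ map inr (u :: q) ++ map inl (z' :: p2) ++ w3.
  by rewrite eqw eqw1 eqw1' eqw2 eqw2'.
have st1 : (inl z, inr u) \in steps w.
  by rewrite eqw map_rcons cat_rcons mem_steps_cat.
have [q' [u' eqq]] : exists q' u', u :: q = rcons q' u'.
  by exists (belast u q), (last u q); rewrite lastI.
have st2 : (inr u', inl z') \in steps w.
  by rewrite eqw eqq (map_rcons inr) cat_rcons catA mem_steps_cat.
have zz' : z != z'.
  apply: contraTneq uw => zz'; rewrite eqw zz' map_rcons cat_uniq.
  by rewrite !negb_and; apply/orP; right; apply/orP; left; rewrite negbK; apply/hasP;
     exists (inl z'); rewrite ?mem_rcons ?mem_cat ?mem_head ?orbT //= ?mem_head.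
have w30 : w3 = [::].
  case: Hw3 => [//|[v [w4 eqw3]]].
  have [p' [y' eqp]] : exists p' y', z' :: p2 = rcons p' y'.
    by exists (belast z' p2), (last z' p2); rewrite lastI.
  have st3 : (inl y', inr v) \in steps w.
    by rewrite eqw eqp eqw3 (map_rcons inl p') cat_rcons 2!catA mem_steps_cat.
  have vq : v \notin u :: q.
    apply: contraTN uw => vq; rewrite eqw eqw3 catA uniq_catC.
    rewrite [X in uniq X](_ : _ = inl z' :: map inl p2 ++ [:: inr v] ++ w4 ++
      map inl (rcons p1 z) ++ map inr (u :: q)) //; last by rewrite /= -!catA.
    rewrite -cat_cons uniq_catCA cat_uniq; apply/negP => /and3P [_ + _].
    by case/negP; apply/hasP; exists (inr v); rewrite ?mem_head //
       !mem_cat (mem_map inr_inj) vq !orbT.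
  have uq : u \in u :: q by rewrite mem_head.
  have u'q : u' \in u :: q by rewrite eqq mem_rcons mem_head.
  move: (lr _ _ st1) (rl _ _ st2) (lr _ _ st3) zz' vq uq u'q.
  by do 2![case=> [[-> ->]|[-> ->]]]; case=> [[_ ->]|[_ ->]]; rewrite ?eqxx //;
     move=> _ /negbTE ->.
exists p1, p2, (u :: q); split=> //.
have hq c : head c (u :: q) = u by [].
have lq c : last c (u :: q) = u' by rewrite eqq last_rcons.
rewrite eqw w30 cats0 !hq !lq.
move: (lr _ _ st1) (rl _ _ st2) zz'.
by do 2![case=> [[-> ->]|[-> ->]]]; rewrite ?eqxx //; [left | right].
Qed.

End SpliceRel.

Section InsertPath.

Variables T U : eqType.

Definition insert_path (x y : T) (p : seq T) (q : seq U) : seq (T + U) :=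
  if (x, y) \in steps p
  then map inl (take (index y p) p) ++ map inr q ++ map inl (drop (index y p) p)
  else map inl (take (index x p) p) ++ map inr (rev q) ++ map inl (drop (index x p) p).

Lemma insert_path_forward x y p1 p2 q : uniq (rcons p1 x ++ y :: p2) ->
  insert_path x y (rcons p1 x ++ y :: p2) q
  = map inl (rcons p1 x) ++ map inr q ++ map inl (y :: p2).
Proof.
rewrite cat_uniq => /and3P [_ /hasPn dis _].
rewrite /insert_path steps_cat mem_cat mem_head orbT index_cat.
rewrite (negbTE (dis y (mem_head _ _))) /= eqxx addn0.
by rewrite take_size_cat // drop_size_cat.
Qed.

Lemma insert_path_backward x y p1 p2 q : uniq (rcons p1 y ++ x :: p2) ->
  insert_path x y (rcons p1 y ++ x :: p2) q
  = map inl (rcons p1 y) ++ map inr (rev q) ++ map inl (x :: p2).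
Proof.
rewrite cat_uniq => /and3P [_ /hasPn dis _].
have xp1 : x \notin rcons p1 y := dis x (mem_head _ _).
have yp2 : y \notin x :: p2.
  by apply: contraT; rewrite negbK => /dis; rewrite mem_rcons mem_head.
have nxy : x != y by move: yp2; rewrite in_cons eq_sym => /norP [].
rewrite /insert_path steps_cat mem_cat in_cons xpair_eqE (negbTE nxy) /=.
have -> : ((x, y) \in steps (rcons p1 y)) = false.
  by apply: contraNF xp1 => /mem_steps [].
have -> : ((x, y) \in steps (x :: p2)) = false.
  by apply: contraNF yp2 => /mem_steps [].
rewrite /= index_cat (negbTE xp1) /= eqxx addn0.
by rewrite take_size_cat // drop_size_cat.
Qed.

Lemma insert_path_inj x y p q p' q' :
  insert_path x y p q = insert_path x y p' q' -> p = p' /\ q = q'.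
Proof.
have getlK p0 q0 : pmap (@getl T U) (insert_path x y p0 q0) = p0.
  by rewrite /insert_path; case: ifP => _; rewrite !getE cat_take_drop.
move=> eq_ins; have eqp : p = p' by rewrite -[p](getlK _ q) eq_ins getlK.
split=> //; move/(congr1 (pmap (@getr T U))): eq_ins.
by rewrite eqp /insert_path; case: ifP => _; rewrite !getE // => /(can_inj revK).
Qed.

End InsertPath.

Definition exactly (A : eqType) (P : pred A) (N : nat) :=
  exists L : seq A, [/\ uniq L, size L = N & L =i P].

Lemma exactly_splice (T U : finType) (e : rel T) (d : rel U) x y a b F s t N M :
    symmetric d -> ~~ joined F x y ->
    exactly (ham_path (enum T) e ((x, y) :: F) s t) N ->
    exactly (ham_path (enum U) d [::] a b) M ->
  exactly (ham_path (enum {: T + U}) (splice_rel e d x y a b)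
    (map (mapp inl) F) (inl s) (inl t)) (N * M).
Proof.
move=> d_sym nF [L [uL sL memL]] [K [uK sK memK]].
exists [seq insert_path x y p q | p <- L, q <- K]; split.
- apply: allpairs_uniq => // - [p q] [p' q'] _ _ /= /insert_path_inj.
  by case=> -> ->.
- by rewrite size_allpairs sL sK.
have ham_nil q : ham_path (enum U) d [::] a b q ->
    [/\ q != [::], head a q = a & last a q = b].
  case/and5P => /perm_enum [_ mq] /eqP ha /eqP la _ _; split=> //.
  by apply: contraTneq (mq a) => ->.
have nF' : ~~ joined F y x by rewrite joinedC.
have sw w : ham_path (enum {: T + U}) (splice_rel e d x y a b)
      (map (mapp inl) F) (inl s) (inl t) w
    = ham_path (enum {: T + U}) (splice_rel e d y x b a)
      (map (mapp inl) F) (inl s) (inl t) w.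
  exact/eq_ham_path/splice_rel_swap.
move=> w; apply/allpairsP/idP => [[[p q] /=]|].
  case; rewrite memL memK => pP qP ->.
  have /and5P [/perm_enum [up _] _ _ _ /andP [/orP Hxy _]] := pP.
  case: Hxy => /steps_split [p1 [p2 eqp]]; subst p.
    have [q0 qa qb] := ham_nil _ qP.
    by rewrite insert_path_forward // -topredE /= ham_path_splice // ; apply/andP.
  have qP' := ham_path_rev d_sym qP.
  have [] := ham_nil _ qP; case: q qP qP' => // u q qP qP' _ _ _.
  have /and5P [_ /eqP qb /eqP qa _ _] := qP'.
  rewrite insert_path_backward // -topredE /= sw ham_path_splice //.
    by rewrite -ham_path_swap; apply/andP.
  by rewrite -size_eq0 size_rev.
rewrite -topredE /= => wP.
have [p1 [p2 [q [q0 [[eqw qa qb]|[eqw qb qa]]]]]] := splice_ham_decomp wP; subst w.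
  move: wP; rewrite ham_path_splice // => /andP [pP qP].
  exists (rcons p1 x ++ y :: p2, q); rewrite memL memK; split=> //=.
  by rewrite insert_path_forward //; have /and5P [/perm_enum []] := pP.
move: wP; rewrite sw ham_path_splice // -ham_path_swap => /andP [pP qP].
exists (rcons p1 y ++ x :: p2, rev q); rewrite memL memK; split=> //=.
  exact: ham_path_rev.
by rewrite insert_path_backward ?revK //; have /and5P [/perm_enum []] := pP.
Qed.

Definition splice (G H : sgraph) (x y : G) (a b : H) : sgraph :=
  SGraph (splice_rel_sym x y a b (@adj_sym G) (@adj_sym H))
         (splice_rel_irrefl x y a b (@adj_irrefl G) (@adj_irrefl H)).

Lemma card_splice (G H : sgraph) (x y : G) (a b : H) :
  #|splice x y a b| = #|G| + #|H|.
Proof. exact: card_sum. Qed.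

Lemma card_set_sum (T U : finType) (P : pred (T + U)) :
  #|[set z | P z]| = #|[set x | P (inl x)]| + #|[set u | P (inr u)]|.
Proof. by rewrite !cardsE -!sum1_card big_sumType. Qed.

Lemma degree_splice_inl (G H : sgraph) (x y : G) (a b : H) (z : G) : a != b ->
  degree (inl z : splice x y a b) = degree z + ((x == z) + (y == z)).
Proof.
move=> ab; rewrite /degree card_set_sum /=; congr (_ + _).
rewrite ![_ == z]eq_sym; case: (z =P x) => _; case: (z =P y) => _;
  rewrite /= ?addn0 ?add0n.
- transitivity #|[set a; b]|; last by rewrite cards2 ab.
  by apply: eq_card => u; rewrite !inE.
- by rewrite -(cards1 a); apply: eq_card => u; rewrite !inE orbF.
- by rewrite -(cards1 b); apply: eq_card => u; rewrite !inE.
- by apply: eq_card0 => u; rewrite !inE.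
Qed.

Lemma degree_splice_inr (G H : sgraph) (x y : G) (a b : H) (u : H) : a != b ->
  degree (inr u : splice x y a b) = degree u + ((a == u) + (b == u)).
Proof.
move=> ab; rewrite /degree card_set_sum addnC /=; congr (_ + _).
rewrite ![_ == u]eq_sym; case: (u =P a) => [ua|_]; case: (u =P b) => [ub|_];
  rewrite /= ?addn0 ?add0n.
- by rewrite -ua -ub eqxx in ab.
- rewrite -(cards1 x); apply: eq_card => v; rewrite !inE.
  by rewrite andbT andbF orbF.
- by rewrite -(cards1 y); apply: eq_card => v; rewrite !inE andbF andbT.
- by apply: eq_card0 => v; rewrite !inE !andbF.
Qed.

Definition ends (T : eqType) (F : seq (T * T)) (v : T) :=
  \sum_(f <- F) ((f.1 == v) + (f.2 == v)).

Fixpoint simple_edges (T : eqType) (F : seq (T * T)) :=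
  if F is f :: F' then ~~ joined F' f.1 f.2 && simple_edges F' else true.

Lemma simple_edges_map (T T' : eqType) (f : T -> T') F :
  injective f -> simple_edges (map (mapp f) F) = simple_edges F.
Proof. by move=> fI; elim: F => //= a F ->; rewrite (joined_map fI). Qed.

(* [n] vertices, [N] paths, [k] virtual edges besides the pair of terminals; the
   graph becomes [r]-regular once virtual edges and terminals are joined to links. *)
Definition link (r n N k : nat) := exists (G : sgraph) (s t : G) (F : seq (G * G)),
  [/\ #|G| = n, size F = k, s != t & simple_edges F]
  /\ (forall v, degree v + ends ((s, t) :: F) v = r)
  /\ exactly (ham_path (enum G) (@adj G) F s t) N.

Lemma link_splice r n N k m M :
  link r n N k.+1 -> link r m M 0 -> link r (n + m) (N * M) k.
Proof.
move=> [G [s [t [F [[nG sF st simF] [degG cG]]]]]].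
case: F sF simF degG cG => // - [x y] F [sF] /andP /= [nF simF] degG cG.
move=> [H [a [b [K [[nH /size0nil K0 ab _] [degH cH]]]]]]; subst K.
exists (splice x y a b), (inl s), (inl t), (map (mapp inl) F); split; [split | split].
- by rewrite card_splice nG nH.
- by rewrite size_map.
- by [].
- by rewrite simple_edges_map //; apply: inl_inj.
- case=> v.
  + rewrite degree_splice_inl // -(degG v) /ends !big_cons /= big_map -addnA.
    by congr (_ + _); rewrite addnCA.
  + rewrite degree_splice_inr // -(degH v) /ends !big_cons /= big_nil addn0 big_map.
    by rewrite big1 ?addn0.
- exact: exactly_splice (@adj_sym H) nF cG cH.
Qed.

(** * Closing two links to a ring *)

Section CycleEdges.

Variable T : finType.
Implicit Types c : seq T.

Lemma cycle_edges_rot n c : uniq c -> cycle_edges (rot n c) = cycle_edges c.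
Proof.
move=> uc; apply/setP => E.
apply/imsetP/imsetP => - [x xc ->]; exists x; rewrite ?mem_rot ?next_rot //.
by rewrite mem_rot in xc.
Qed.

Lemma cycle_edges_rev c : uniq c -> cycle_edges (rev c) = cycle_edges c.
Proof.
move=> uc; apply/setP => E; apply/imsetP/imsetP => - [x xc ->].
  rewrite mem_rev in xc; exists (prev c x); first by rewrite mem_prev.
  by rewrite next_rev // next_prev // setUC.
by exists (next c x); rewrite ?mem_rev ?mem_next // next_rev // prev_next // setUC.
Qed.

Lemma mem_cycle_edges c x y : uniq c -> x \in c ->
  [set x; y] \in cycle_edges c -> y = next c x \/ y = prev c x.
Proof.
move=> uc xc /imsetP [z zc /setP E].
have := E x; have := E y; rewrite !inE !eqxx orbT /=.
move=> /esym/orP [/eqP yz|/eqP yz] /esym/orP [/eqP xz|/eqP xz].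
- left; have := E (next c z); rewrite !inE eqxx orbT xz yz orbb.
  by move/eqP.
- by right; rewrite xz yz prev_next.
- by left; rewrite yz xz.
- left; have := E z; rewrite !inE eqxx xz yz orbb.
  by move/eqP => zz; rewrite -zz.
Qed.

(* Fixing the head and the last vertex rules out the rotations and the reversal. *)
Lemma cycle_edges_inj c c' z :
    uniq c -> uniq c' -> size c = size c' -> 2 < size c ->
    head z c = head z c' -> last z c = last z c' ->
  cycle_edges c = cycle_edges c' -> c = c'.
Proof.
move=> uc uc' eqsz gt2 eqh eql eqC.
apply: (@eq_from_nth _ z) => // i.
elim/ltn_ind: i => - [|i] IH lti; first by rewrite !nth0.
have lti' := ltnW lti; have ltc' : i.+1 < size c' by rewrite -eqsz.
have eqi := IH i (ltnSn _) lti'.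
set v := nth z c i in eqi.
have nextE (d : seq T) j : uniq d -> j.+1 < size d -> next d (nth z d j) = nth z d j.+1.
  move=> ud ltj; rewrite next_nth mem_nth ?(ltnW ltj) // index_uniq ?(ltnW ltj) //.
  by case: d ud ltj => //= y d _ ltj; apply: set_nth_default.
have prevE (d : seq T) j : uniq d -> j < size d ->
    prev d (nth z d j) = if j is j'.+1 then nth z d j' else last z d.
  move=> ud ltj; rewrite prev_nth mem_nth //.
  case: d ud ltj => //= y d /andP [yd ud]; case: j => [|j] ltj /=.
    by rewrite memNindex // -last_nth.
  by rewrite index_uniq //; apply: (@set_nth_default _ (y :: d)); rewrite ltnW.
have : [set v; nth z c' i.+1] \in cycle_edges c.
  rewrite eqC -nextE // eqi; apply: imset_f; rewrite mem_nth //.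
  exact: ltn_trans ltc'.
case/mem_cycle_edges => // [|->|]; first by rewrite mem_nth.
  by rewrite /v nextE.
rewrite /v prevE //; case: i IH lti ltc' {lti' eqi v} => [|i] IH lti ltc'.
  rewrite eql -nth_last => /eqP; rewrite nth_uniq -?eqsz ?ltn_predL ?(ltnW lti) //.
  by case: (size c) gt2 => [|[|[]]].
rewrite /= IH //; last by rewrite ltnW // ltnW.
by move=> /eqP; rewrite nth_uniq ?gtn_eqF // ltnW // ltnW.
Qed.

End CycleEdges.

Lemma cycle_steps (T : eqType) (e : rel T) z c : c != [::] ->
  cycle e c = all (fun a => e a.1 a.2) (steps c) && e (last z c) (head z c).
Proof.
case: c => //= x c _; rewrite rcons_path path_steps; congr (_ && _).
Qed.

Lemma head_eq_last (T : eqType) (z x : T) p :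
  uniq p -> head z p = last z p -> x \in p -> x = last z p.
Proof.
case: p => //= y p /andP [yp _]; case/lastP: p yp => [|p y'] /=.
  by rewrite inE => _ _ /eqP.
by rewrite last_rcons => + eqy; rewrite eqy mem_rcons mem_head.
Qed.

Section Ring.

Variables (T U : finType) (e : rel T) (d : rel U) (s t : T) (a b : U).
Hypothesis st : s != t.

Let ring_rel := splice_rel e d s t a b.

Lemma ring_cycle p q : p != [::] -> q != [::] ->
    head s p = s -> last s p = t -> head b q = b -> last b q = a ->
  cycle ring_rel (map inl p ++ map inr q)
  = all (fun c => e c.1 c.2) (steps p) && all (fun c => d c.1 c.2) (steps q).
Proof.
move=> p0 q0 ps pt qb qa.
rewrite (@cycle_steps _ _ (inl s)); last by case: (p) p0.
rewrite (steps_cat_head (inl s)); [|by case: (p) p0|by case: (q) q0].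
have hq : head (inl s) (map inr q) = inr b :> T + U by case: (q) q0 qb => //= ? ? _ ->.
have hp : head (inl s) (map inl p ++ map inr q) = inl s :> T + U.
  by case: (p) p0 ps => //= ? ? _ ->.
have lp : last (inl s) (map inl p) = inl t :> T + U by rewrite last_map pt.
have lq : last (inl s) (map inl p ++ map inr q) = inr a :> T + U.
  by rewrite last_cat; case: (q) q0 qa => //= u q1 _ <-; rewrite last_map.
rewrite hq hp lp lq all_cat /= !eqxx orbT /= andbT.
by rewrite !steps_map !all_map.
Qed.

Lemma ring_cycle_decomp c :
    cycle ring_rel c -> uniq c -> (forall z, z \in c) ->
  exists i p q, rot i c = map inl p ++ map inr q /\
    ([/\ head s p = s, last s p = t, head b q = b & last b q = a]
  \/ [/\ head t p = t, last t p = s, head a q = a & last a q = b]).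
Proof.
move=> cc uc mc.
have [i c' eqc'] := rot_to (mc (inr a)).
have [q0 [w [eqw Hw]]] := inr_run (inr a :: c').
have [z [w' {Hw} eqw']] : exists z w', w = inl z :: w'.
  case: Hw => [w0|//]; have : inl s \in rot i c by rewrite mem_rot.
  by rewrite eqc' eqw w0 cats0 => /mapP [].
have q00 : q0 != [::] by case: (q0) eqw => //; rewrite eqw'.
have [i' [p [w1 [rotW Hw1]]]] : exists i' p w1, rot i' c = map inl (z :: p) ++ w1 /\
    (exists u w2, w1 = inr u :: w2) /\ forall x, last x w1 = inr (last a q0).
  have [p [w1 [eqw1 Hw1]]] := inl_run w'.
  exists (rot_add c i (size q0)), p, (w1 ++ map inr q0); split.
    by rewrite -rot_rot_add eqc' eqw -(size_map (@inr T U)) rot_size_cat eqw' eqw1 /= -catA.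
  split; last by move=> x; rewrite last_cat; case: (q0) q00 => //= u q1 _; rewrite last_map.
  case: Hw1 => [->|[u [w2 ->]]]; last by exists u, (w2 ++ map inr q0).
  by case: (q0) q00 => //= u q1 _; exists u, (map inr q1).
have [[u [w2 eqw1]] lastw1] := Hw1; set ul := last a q0 in lastw1.
have [q [w3 [eqw2 Hw3]]] := inr_run w2.
pose W := rot i' c.
have eqW : W = map inl (z :: p) ++ map inr (u :: q) ++ w3 by rewrite /W rotW eqw1 eqw2.
have uW : uniq W by rewrite rot_uniq.
have mW x : x \in W by rewrite mem_rot.
have W0 : W != [::] by rewrite eqW.
have : cycle ring_rel W by rewrite rot_cycle.
rewrite (cycle_steps _ (inl s)) // => /andP [/allP sW lW].
have cross v x : (ring_rel (inl v) (inr x) -> (v, x) = (s, a) \/ (v, x) = (t, b)) *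
                 (ring_rel (inr x) (inl v) -> (v, x) = (s, a) \/ (v, x) = (t, b)).
  by split=> /orP [] /andP [/eqP -> /eqP ->]; auto.
have {lW} zul : (z, ul) = (s, a) \/ (z, ul) = (t, b).
  by apply: (cross _ _).2; move: lW; rewrite /W rotW last_cat lastw1.
have pu : (last z p, u) = (s, a) \/ (last z p, u) = (t, b).
  apply: (cross _ _).1; apply: (sW (_, _)).
  by rewrite eqW lastI map_rcons cat_rcons mem_steps_cat.
have w30 : w3 = [::].
  case: Hw3 => [//|[z' [w4 eqw3]]].
  have qz : (z', last u q) = (s, a) \/ (z', last u q) = (t, b).
    apply: (cross _ _).2; apply: (sW (_, _)).
    by rewrite eqW eqw3 (lastI u q) (map_rcons inr) cat_rcons catA mem_steps_cat.
  have z'p : z' \notin z :: p.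
    apply: contraTN uW => z'p; rewrite eqW eqw3 cat_uniq; apply/negP.
    case/and3P => _ /hasPn /(_ (inl z')) + _.
    by rewrite mem_cat mem_head orbT => /(_ isT); rewrite (mem_map inl_inj) z'p.
  have ulq : ul \notin u :: q.
    apply: contraTN uW => ulq; rewrite eqW eqw3 catA cat_uniq; apply/negP.
    case/and3P => _ /hasPn dis _.
    have : inr ul \in inl z' :: w4.
      move: (lastw1 (inl s)); rewrite eqw1 eqw2 eqw3 /= last_cat /= => <-.
      exact: mem_last.
    by move/dis; rewrite mem_cat (mem_map inr_inj) ulq orbT.
  have zp := mem_head z p; have lp := mem_last z p.
  have uq := mem_head u q; have lq := mem_last u q.
  move: zul pu qz z'p ulq zp lp uq lq.
  by do 3![case=> [[-> ->]|[-> ->]]] => /negP z'p /negP ulq.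
rewrite w30 cats0 in eqW.
exists i', (z :: p), (u :: q); split=> //.
have equl : last u q = ul.
  by have := lastw1 (inl s); rewrite eqw1 eqw2 w30 cats0 /= last_map => - [].
have uzp : uniq (z :: p) by move: uW; rewrite eqW uniq_sum => /andP [].
have szp v : v \in z :: p by rewrite -(mem_inl_cat _ _ (u :: q)) -eqW.
have zlp : z != last z p.
  apply: contraNneq st => zlp.
  by rewrite (@head_eq_last _ z s _ uzp zlp (szp s)) (@head_eq_last _ z t _ uzp zlp (szp t)).
rewrite /= equl; move: zul pu zlp.
by do 2![case=> [[-> ->]|[-> ->]]]; rewrite ?eqxx //; [left | right].
Qed.

End Ring.

Lemma ham_path0P (T : finType) (e : rel T) s t p :
  reflect [/\ uniq p, forall x, x \in p, head s p = s, last s p = t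
            & all (fun c => e c.1 c.2) (steps p)]
          (ham_path (enum T) e [::] s t p).
Proof.
have E : all (fun c => e c.1 c.2 || joined [::] c.1 c.2) (steps p)
    = all (fun c => e c.1 c.2) (steps p).
  by apply: eq_all => c; rewrite /joined !in_nil !orbF.
apply: (iffP and5P); rewrite E.
  by case=> /perm_enum [up mp] /eqP ps /eqP pt pe _; split.
by case=> up mp -> -> pe; split=> //; apply/perm_enum.
Qed.

Lemma num_hamiltonian_cycles_splice (G H : sgraph) (s t : G) (a b : H) N M :
    s != t -> a != b ->
    exactly (ham_path (enum G) (@adj G) [::] s t) N ->
    exactly (ham_path (enum H) (@adj H) [::] a b) M ->
  num_hamiltonian_cycles (splice s t a b) = N * M.
Proof.
move=> st ab [L [uL sL memL]] [K [uK sK memK]].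
have cardS (T : finType) (x y : T) : x != y -> 1 < #|T|.
  by move=> xy; rewrite (cardD1 x) inE add1n ltnS; apply/card_gt0P; exists y;
     rewrite !inE eq_sym xy.
have gt2 : 2 < #|splice s t a b|.
  by rewrite card_splice (leq_trans _ (leq_add (cardS _ _ _ st) (cardS _ _ _ ab))).
pose ring (p : seq G) (q : seq H) : seq (splice s t a b) := map inl p ++ map inr (rev q).
have revP q : q \in K -> [/\ uniq (rev q), forall x, x \in rev q,
    head b (rev q) = b, last b (rev q) = a
    & all (fun c => @adj H c.1 c.2) (steps (rev q))].
  by rewrite memK => /(ham_path_rev (@adj_sym H)) /ham_path0P.
have sumP p q : p \in L -> q \in K -> uniq (ring p q) /\ forall x, x \in ring p q.
  rewrite memL => /ham_path0P [up mp _ _ _] /revP [uq mq _ _ _].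
  split; first by rewrite uniq_sum up.
  by case=> x; rewrite ?mem_inl_cat ?mem_inr_cat.
have size_full (T : finType) (c : seq T) : uniq c -> (forall x, x \in c) -> size c = #|T|.
  by move=> uc mc; rewrite -(card_uniqP uc); apply: eq_card => x; rewrite mc.
have ne0 (T : eqType) (x : T) (c : seq T) : x \in c -> c != [::] by case: c.
pose C := [seq cycle_edges (ring p q) | p <- L, q <- K].
suff eqC : [set D | @hamiltonian_cycle (splice s t a b) D] =i C.
  have uC : uniq C.
    apply: allpairs_uniq => // - [p q] [p' q'].
    move=> /allpairsP [[p1 q1] /= [pL qK [-> ->]]].
    move=> /allpairsP [[p2 q2] /= [pL' qK' [-> ->]]] /= eqE.
    have [ur mr] := sumP _ _ pL qK; have [ur' mr'] := sumP _ _ pL' qK'.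
    have /ham_path0P [_ mp hp _ _] : ham_path (enum G) (@adj G) [::] s t p1.
      by move: pL; rewrite memL.
    have /ham_path0P [_ mp' hp' _ _] : ham_path (enum G) (@adj G) [::] s t p2.
      by move: pL'; rewrite memL.
    have [_ mq _ lq _] := revP _ qK; have [_ mq' _ lq' _] := revP _ qK'.
    have headE p3 q3 : s \in p3 -> head s p3 = s -> head (inl s) (ring p3 q3) = inl s.
      by case: p3 => //= ? ? _ ->.
    have lastE p3 q3 :
        a \in rev q3 -> last b (rev q3) = a -> last (inl s) (ring p3 q3) = inr a.
      rewrite /ring last_cat; case: (rev q3) => //= ? ? _ <-.
      by rewrite last_map.
    have eqr : ring p1 q1 = ring p2 q2.
      apply: (@cycle_edges_inj _ _ _ (inl s)) => //; rewrite ?size_full //.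
        by rewrite !headE.
      by rewrite !lastE.
    have := congr1 (pmap (@getl G H)) eqr; rewrite !getE => ->.
    by have := congr1 (pmap (@getr G H)) eqr; rewrite !getE => /(can_inj revK) ->.
  rewrite /num_hamiltonian_cycles (eq_card eqC) (card_uniqP uC).
  by rewrite size_allpairs sL sK.
move=> E; rewrite inE /hamiltonian_cycle gt2 /=.
apply/existsP/allpairsP => [[c /andP [/andP [cc uc] /eqP ->]]|[[p q] /= [pL qK ->]]].
  have mc x : x \in tval c.
    have eqcard : #|tval c| = #|splice s t a b|.
      by rewrite (card_uniqP uc) size_tuple.
    by have /(_ x) -> := elimT (subset_cardP eqcard) (subset_predT _).
  have [i [p [q [eqc Hpq]]]] := ring_cycle_decomp st cc uc mc.
  have /andP [up uq] : uniq p && uniq q.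
    by rewrite -(uniq_sum p q) -eqc rot_uniq.
  have mp x : x \in p by rewrite -(mem_inl_cat _ _ q) -eqc mem_rot.
  have mq x : x \in q by rewrite -(mem_inr_cat _ p) -eqc mem_rot.
  have [p0 q0] := (ne0 _ _ _ (mp s), ne0 _ _ _ (mq a)).
  have ccr : cycle (@adj (splice s t a b)) (map inl p ++ map inr q).
    by rewrite -eqc rot_cycle.
  rewrite -(cycle_edges_rot i uc) eqc.
  case: Hpq => - [hp lp hq lq].
    move: ccr; rewrite ring_cycle // => /andP [ep eq_].
    exists (p, rev q); rewrite /= memL memK /ring revK; split=> //.
      exact/ham_path0P.
    by apply: (ham_path_rev (@adj_sym H)); apply/ham_path0P.
  have ccr' : cycle (splice_rel (@adj G) (@adj H) t s b a) (map inl p ++ map inr q).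
    by rewrite -(eq_cycle (splice_rel_swap _ _ s t a b)).
  move: ccr'; rewrite ring_cycle // => /andP [ep eq_].
  exists (rev p, q); rewrite /= memL memK; split=> //.
  - by apply: (ham_path_rev (@adj_sym G)); apply/ham_path0P.
  - exact/ham_path0P.
  have uc' : uniq (map inl p ++ map inr q : seq (splice s t a b)).
    by rewrite uniq_sum up.
  rewrite -(cycle_edges_rev uc') rev_cat -!map_rev.
  rewrite -(cycle_edges_rot (size (rev q))); last by rewrite !map_rev -rev_cat rev_uniq.
  by rewrite -(size_map (@inr G H)) rot_size_cat.
have [ur mr] := sumP _ _ pL qK.
have szr : size (ring p q) == #|splice s t a b| by rewrite size_full.
exists (Tuple szr); rewrite eqxx andbT /= /ucycleb ur andbT.
move: pL qK; rewrite memL => /ham_path0P [up mp hp lp ep] /revP [uq mq hq lq eq_].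
rewrite /ring /= ring_cycle //; first by rewrite ep.
- exact: ne0 (mp s).
- exact: ne0 (mq a).
Qed.

Lemma link_ring r n N m M : link r n N 0 -> link r m M 0 ->
  exists G : sgraph,
    [/\ #|G| = n + m, regular r G & num_hamiltonian_cycles G = N * M].
Proof.
move=> [G [s [t [F [[nG /size0nil F0 st _] [degG cG]]]]]]; subst F.
move=> [H [a [b [F [[nH /size0nil F0 ab _] [degH cH]]]]]]; subst F.
exists (splice s t a b); split.
- by rewrite card_splice nG nH.
- case=> v.
    by rewrite degree_splice_inl // -(degG v) /ends big_seq1.
  by rewrite degree_splice_inr // -(degH v) /ends big_seq1.
- exact: num_hamiltonian_cycles_splice.
Qed.

(** * Counting paths in small links *)

Section Search.

Variables (T : eqType) (V : seq T) (e : rel T) (F : seq (T * T)) (s t : T).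

(* Pruning: when the path leaves [x], the virtual neighbours of [x] must be among
   the vertices visited so far and the next one. *)
Definition may_extend (p : seq T) (y : T) :=
  if p is x :: p' then
    [&& y \notin p, e x y || joined F x y
      & all (fun f => ((f.1 == x) ==> (f.2 \in y :: p'))
                   && ((f.2 == x) ==> (f.1 \in y :: p'))) F]
  else true.

Fixpoint search n p :=
  if n is n'.+1
  then flatten [seq search n' (y :: p) | y <- V & may_extend p y]
  else [:: rev p].

Lemma uniq_cat_cons_inj (x : T) p1 p2 q1 q2 : uniq (p1 ++ x :: p2) ->
  p1 ++ x :: p2 = q1 ++ x :: q2 -> p1 = q1 /\ p2 = q2.
Proof.
move=> u eqw.
have idx r1 r2 : uniq (r1 ++ x :: r2) -> index x (r1 ++ x :: r2) = size r1.
  rewrite cat_uniq => /and3P [_ /hasPn /(_ x (mem_head _ _)) /negbTE xr1 _].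
  by rewrite index_cat xr1 /= eqxx addn0.
have sz : size p1 = size q1 by rewrite -(idx p1 p2) // eqw idx // -eqw.
by move/eqP: eqw; rewrite eqseq_cat // eqseq_cons eqxx => /andP [/eqP -> /eqP ->].
Qed.

Lemma mem_search w p : uniq V -> ham_path V e F s t (rev p ++ w) -> p != [::] ->
  rev p ++ w \in search (size w) p.
Proof.
move=> uV; elim: w p => [|y w IH] p hw; first by rewrite cats0 /= inE.
case: p hw => // x p hw _; have /and5P [pV _ _ /allP ew /allP Fw] := hw.
have eqw : rev (x :: p) ++ y :: w = rev p ++ x :: y :: w.
  by rewrite rev_cons cat_rcons.
have eqw' : rev (x :: p) ++ y :: w = rev (y :: x :: p) ++ w.
  by rewrite [rev (y :: _)]rev_cons cat_rcons.
have uw : uniq (rev (x :: p) ++ y :: w) by rewrite (perm_uniq pV).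
have forced v : joined (steps (rev (x :: p) ++ y :: w)) x v -> v \in y :: p.
  rewrite eqw in uw *; case/orP => /steps_split [w1 [w2]].
    rewrite cat_rcons => /(uniq_cat_cons_inj uw) [_ [<- _]].
    exact: mem_head.
  move/(uniq_cat_cons_inj uw) => [eqp _].
  by rewrite in_cons -mem_rev eqp mem_rcons mem_head orbT.
apply/flatten_mapP; exists y; last first.
  by rewrite eqw'; apply: IH; rewrite -?eqw'.
rewrite mem_filter -(perm_mem pV) mem_cat mem_head orbT andbT /=; apply/and3P; split.
- move: uw; rewrite cat_uniq => /and3P [_ /hasPn /(_ y (mem_head _ _)) + _].
  by rewrite mem_rev.
- by apply: (ew (x, y)); rewrite eqw mem_steps_cat.
- apply/allP => - [f1 f2] /Fw /= Ff; apply/andP; split; apply/implyP => /eqP fx;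
    [rewrite fx in Ff | rewrite fx joinedC in Ff]; exact: forced.
Qed.

End Search.

Definition core_rel (E : seq (nat * nat)) : rel nat :=
  fun x y => (x != y) && joined E x y.

Lemma core_rel_sym E : symmetric (core_rel E).
Proof. by move=> x y; rewrite /core_rel eq_sym joinedC. Qed.

Lemma core_rel_irrefl E : irreflexive (core_rel E).
Proof. by move=> x; rewrite /core_rel eqxx. Qed.

Definition core m E : sgraph :=
  @SGraph 'I_m (relpre val (core_rel E))
    (fun x y => core_rel_sym E (val x) (val y)) (fun x => core_rel_irrefl E (val x)).

Lemma degree_core m E (v : core m E) :
  degree v = count (core_rel E (val v)) (iota 0 m).
Proof.
by rewrite /degree cardsE -sum1_card -(big_mkord (core_rel E (val v)) (fun _ => 1))
  sum1_count /index_iota subn0.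
Qed.

Definition core_paths m E F s t :=
  undup [seq p <- search (iota 0 m) (core_rel E) F m.-1 [:: s]
        | ham_path (iota 0 m) (core_rel E) F s t p].

Definition core_check m E F s t r :=
  [&& s < m, t < m, s != t, simple_edges F,
      all (fun f => (f.1 < m) && (f.2 < m)) F
    & all (fun v => count (core_rel E v) (iota 0 m)
           + sumn [seq (f.1 == v) + (f.2 == v) | f <- (s, t) :: F] == r) (iota 0 m)].

Lemma core_link m E F s t r : core_check m.+1 E F s t r ->
  link r m.+1 (size (core_paths m.+1 E F s t)) (size F).
Proof.
case/and5P => sm tm st simF /andP [/allP Fm /allP deg].
pose FI := map (mapp (@inord m)) F.
have FIK : map (mapp val) FI = F.
  rewrite -map_comp -[RHS]map_id; apply/eq_in_map => - [f1 f2] /Fm /= /andP [h1 h2].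
  by rewrite /mapp /= !inordK.
have valI : injective (val : 'I_m.+1 -> nat) := val_inj.
have pathE p : ham_path (enum 'I_m.+1) (relpre val (core_rel E)) FI (inord s) (inord t) p
    = ham_path (iota 0 m.+1) (core_rel E) F s t (map val p).
  by rewrite -(ham_path_map valI) FIK val_enum_ord /= !inordK.
exists (core m.+1 E), (inord s), (inord t), FI; split; [split | split].
- exact: card_ord.
- exact: size_map.
- by rewrite -(inj_eq valI) /= !inordK.
- by rewrite -(simple_edges_map _ valI) FIK.
- move=> v; rewrite degree_core -(eqP (deg (val v) _)) ?mem_iota ?ltn_ord //.
  have -> : (s, t) :: F = map (mapp val) ((inord s : 'I_m.+1, inord t) :: FI).
    by rewrite map_cons FIK /mapp /= !inordK.
  by rewrite sumnE !big_map.
exists (map (map (@inord m)) (core_paths m.+1 E F s t)).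
have memP p : (p \in core_paths m.+1 E F s t)
    = ham_path (iota 0 m.+1) (core_rel E) F s t p.
  rewrite mem_undup mem_filter andb_idr // => hp.
  have /and5P [pm /eqP ps _ _ _] := hp; case: p hp pm ps => [|x p] hp pm /= ps.
    by move/perm_size: pm.
  have [szp] : size (x :: p) = m.+1 by rewrite (perm_size pm) size_iota.
  subst x; have := mem_search (p := [:: s]) (iota_uniq 0 m.+1) hp isT.
  by rewrite szp.
have lt_m p : p \in core_paths m.+1 E F s t -> map val (map (@inord m) p) = p.
  rewrite memP => /and5P [/perm_mem pm _ _ _ _].
  rewrite -map_comp -[RHS]map_id; apply/eq_in_map => x.
  by rewrite pm mem_iota => /= xm; rewrite inordK.
split.
- rewrite map_inj_in_uniq ?undup_uniq // => p q /lt_m ep /lt_m eq_ epq.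
  by rewrite -ep epq.
- by rewrite size_map.
- move=> p; apply: etrans (esym (pathE p)); rewrite -memP; apply/mapP/idP => [[q qP ->]|pP].
    by rewrite lt_m.
  by exists (map val p) => //; rewrite -map_comp map_id_in // => x _; rewrite /= inord_val.
Qed.

Definition clique_minus m M :=
  [seq f <- [seq (x, y) | x <- iota 0 m, y <- iota 0 m] | ~~ joined M f.1 f.2].

(* The base graphs were found by a computer search; the path of virtual edges runs
   through r - 3, 0, 1, ..., r - 4, r - 2, and its last edge joins the terminals. *)
Definition base_edges5 : seq (nat * nat) :=
  [:: (0, 4); (0, 6); (0, 7); (1, 4); (1, 6); (1, 7); (2, 3); (2, 4); (2, 5);
    (2, 7); (3, 4); (3, 5); (3, 6); (4, 5); (5, 6); (5, 7); (6, 7)].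

Definition base_edges6 : seq (nat * nat) :=
  [:: (0, 5); (0, 8); (0, 9); (0, 10); (1, 5); (1, 6); (1, 9); (1, 10); (2,
    6); (2, 7); (2, 8); (2, 10); (3, 5); (3, 7); (3, 8); (3, 9); (3, 10); (4,
    5); (4, 6); (4, 7); (4, 9); (4, 10); (5, 6); (5, 8); (6, 7); (6, 8); (7,
    9); (7, 10); (8, 9)].

Definition base_edges7 : seq (nat * nat) :=
  [:: (0, 1); (0, 8); (0, 9); (0, 10); (0, 13); (1, 8); (1, 9); (1, 11); (1,
    13); (2, 6); (2, 8); (2, 9); (2, 12); (2, 13); (3, 7); (3, 8); (3, 9); (3,
    11); (3, 13); (4, 7); (4, 9); (4, 10); (4, 11); (4, 12); (4, 13); (5, 6);
    (5, 7); (5, 8); (5, 9); (5, 10); (5, 12); (6, 7); (6, 9); (6, 10); (6,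
    11); (6, 12); (7, 8); (7, 11); (7, 13); (8, 12); (10, 11); (10, 12); (10,
    13); (11, 12)].

Definition core_links m E F s t r N :=
  core_check m E F s t r && (size (core_paths m E F s t) == N).

Lemma core_linksP m E F s t r N :
  core_links m.+1 E F s t r N -> link r m.+1 N (size F).
Proof. by case/andP => /core_link + /eqP <-. Qed.

Lemma clique_link5 : link 5 6 (2 ^ 3 * 3) 0.
Proof. by apply: (@core_linksP _ (clique_minus 6 [:: (0, 1)]) [::] 0 1); vm_compute. Qed.

Lemma clique_link6 : link 6 7 (2 ^ 3 * 3 * 5) 0.
Proof. by apply: (@core_linksP _ (clique_minus 7 [:: (0, 1)]) [::] 0 1); vm_compute. Qed.

Lemma clique_link7 : link 7 8 (2 ^ 4 * 3 ^ 2 * 5) 0.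
Proof. by apply: (@core_linksP _ (clique_minus 8 [:: (0, 1)]) [::] 0 1); vm_compute. Qed.

Lemma step_link5 : link 5 6 (2 * 3) 1.
Proof.
by apply: (@core_linksP _ (clique_minus 6 [:: (0, 1); (0, 2)]) [:: (0, 2)] 0 1); vm_compute.
Qed.

Lemma step_link6 : link 6 7 (2 ^ 3 * 3) 1.
Proof.
by apply: (@core_linksP _ (clique_minus 7 [:: (0, 1); (0, 2)]) [:: (0, 2)] 0 1); vm_compute.
Qed.

Lemma step_link7 : link 7 8 (2 ^ 3 * 3 * 5) 1.
Proof.
by apply: (@core_linksP _ (clique_minus 8 [:: (0, 1); (0, 2)]) [:: (0, 2)] 0 1); vm_compute.
Qed.

Lemma base_link5 : link 5 8 2 2.
Proof. by apply: (@core_linksP _ base_edges5 [:: (1, 0); (0, 2)] 1 3); vm_compute. Qed.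

Lemma base_link6 : link 6 11 5 3.
Proof.
by apply: (@core_linksP _ base_edges6 [:: (2, 1); (1, 0); (0, 3)] 2 4); vm_compute.
Qed.

Lemma base_link7 : link 7 14 (2 ^ 4) 4.
Proof.
by apply: (@core_linksP _ base_edges7 [:: (3, 2); (2, 1); (1, 0); (0, 4)] 3 5); vm_compute.
Qed.

(** * The families *)

Lemma link_fill r n N j m M :
  link r n N j -> link r m M 0 -> link r (n + m * j) (N * M ^ j) 0.
Proof.
move=> + lM; elim: j n N => [|j IH] n N lN; first by rewrite muln0 addn0 muln1.
by rewrite mulnS addnA expnS mulnA; apply: IH; apply: link_splice.
Qed.

Lemma link_nest r n N m M k :
  link r n N 0 -> link r m M 1 -> link r (n + m * k) (N * M ^ k) 0.
Proof.
move=> lN lM; elim: k => [|k IH]; first by rewrite muln0 addn0 muln1.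
by rewrite mulnS addnCA expnS mulnCA; apply: link_splice.
Qed.

Lemma regular_family r n N j m M K k :
    link r n N j -> link r m M 0 -> link r m K 1 ->
  exists G : sgraph,
    [/\ #|G| = n + m * j + m * k + m, regular r G
      & num_hamiltonian_cycles G = N * M ^ j * K ^ k * M].
Proof.
by move=> lN lM lK; apply: link_ring => //; apply: link_nest => //; apply: link_fill.
Qed.

Lemma count5E a b k :
  a * (a ^ 3 * b) ^ 2 * (a * b) ^ k * (a ^ 3 * b) = a ^ (k + 10) * b ^ (k + 3).
Proof. by rewrite !expnD !expnMn; ring. Qed.

Lemma count6E a b c k :
  c * (a ^ 3 * b * c) ^ 3 * (a ^ 3 * b) ^ k * (a ^ 3 * b * c)
  = a ^ (3 * (k + 4)) * b ^ (k + 4) * c ^ 5.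
Proof. by rewrite mulnDr !expnD !expnMn; ring. Qed.

Lemma count7E a b c k :
  a ^ 4 * (a ^ 4 * b ^ 2 * c) ^ 4 * (a ^ 3 * b * c) ^ k * (a ^ 4 * b ^ 2 * c)
  = a ^ (3 * (k + 8)) * b ^ (k + 10) * c ^ (k + 5).
Proof. by rewrite mulnDr !expnD !expnMn; ring. Qed.

Theorem theorem3 (k : nat) :
  [/\ exists G : sgraph,
        [/\ #|G| = 26 + 6 * k, regular 5 G
          & num_hamiltonian_cycles G = 2 ^ (k + 10) * 3 ^ (k + 3)],
      exists G : sgraph,
        [/\ #|G| = 39 + 7 * k, regular 6 G
          & num_hamiltonian_cycles G = 2 ^ (3 * (k + 4)) * 3 ^ (k + 4) * 5 ^ 5]
    & exists G : sgraph,
        [/\ #|G| = 54 + 8 * k, regular 7 G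
          & num_hamiltonian_cycles G
              = 2 ^ (3 * (k + 8)) * 3 ^ (k + 10) * 5 ^ (k + 5)]].
Proof.
split.
- have [G [nG rG cG]] := regular_family k base_link5 clique_link5 step_link5.
  by exists G; rewrite nG cG count5E addnAC.
- have [G [nG rG cG]] := regular_family k base_link6 clique_link6 step_link6.
  by exists G; rewrite nG cG count6E addnAC.
- have [G [nG rG cG]] := regular_family k base_link7 clique_link7 step_link7.
  by exists G; rewrite nG cG count7E addnAC.
Qed.
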